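(* Let $G$ be a group and let $\mathrm{cl}$ be a homogeneous pregeometry on $G$ which is locally modular. Then $G$ is commutative.
   Context: A pregeometry on a set $X$ is an operator $\mathrm{cl}\colon \mathcal P(X)\to\mathcal P(X)$ such that for all $A\subseteq X$ and $a,b\in X$: $A\subseteq \mathrm{cl}(A)$; $\mathrm{cl}(\mathrm{cl}(A))=\mathrm{cl}(A)$; $a\in\mathrm{cl}(A)$ iff $a\in\mathrm{cl}(A_0)$ for some finite $A_0\subseteq A$; and if $a\in\mathrm{cl}(A\cup\{b\})\setminus\mathrm{cl}(A)$ then $b\in\mathrm{cl}(A\cup\{a\})$. A set $A$ is independent if $a\notin\mathrm{cl}(A\setminus\{a\})$ for all $a\in A$; for $Y\subseteq X$, $\dim(Y)$ is the cardinality of a maximal independent subset of $Y$ (equivalently of a basis of $Y$ with respect to the restricted closure $\mathrm{cl}(\cdot)\cap Y$), and $\dim(X)$ is the dimension of $X$. A pregeometry on the group $G$ is a pregeometry on the underlying set of $G$ such that every group automorphism of $G$ maps $\mathrm{cl}$-closed sets to $\mathrm{cl}$-closed sets (i.e. $f(\mathrm{cl}(A))=\mathrm{cl}(f(A))$). It is homogeneous if $\dim(G)$ is infinite and for every finite $A\subset G$ and all $b,c\in G\setminus\mathrm{cl}(A)$ there is a group automorphism of $G$ fixing $A$ pointwise and mapping $b$ to $c$. The pregeometry is locally modular if $\dim(A\cup B)+\dim(A\cap B)=\dim(A)+\dim(B)$ for all finite-dimensional $\mathrm{cl}$-closed sets $A,B$ with $\dim(A\cap B)>0$. *)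

(* Defs.v *)
From HB Require Import structures.
From mathcomp Require Import all_boot.
From mathcomp Require Import mathcomp_extra boolp classical_sets functions.
From mathcomp Require Import cardinality.

Set Implicit Arguments.
Unset Strict Implicit.
Unset Printing Implicit Defensive.

Local Open Scope classical_set_scope.
Local Open Scope card_scope.

Record pregeometry (X : Type) (cl : set X -> set X) : Prop := Pregeometry {
  pregeometry_ext : forall A, A `<=` cl A ;
  pregeometry_idem : forall A, cl (cl A) = cl A ;
  pregeometry_finitary : forall A a,
    cl A a <-> exists A0, [/\ finite_set A0, A0 `<=` A & cl A0 a] ;
  pregeometry_exchange : forall A a b,
    (cl (A `|` [set b]) `\` cl A) a -> cl (A `|` [set a]) b
}.

Section Dimension.
Variables (X : Type) (cl : set X -> set X).

Definition cl_closed (A : set X) : Prop := cl A = A.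

Definition independent (A : set X) : Prop :=
  forall a, A a -> ~ cl (A `\` [set a]) a.

Definition max_independent (Y B : set X) : Prop :=
  [/\ B `<=` Y, independent B &
      forall C, C `<=` Y -> independent C -> B `<=` C -> C = B].

Definition has_dim (Y : set X) (n : nat) : Prop :=
  exists2 B, max_independent Y B & B #= `I_n.

Definition finite_dim (Y : set X) : Prop := exists n, has_dim Y n.

(* In a pregeometry all maximal independent subsets of Y have the same          *)
(* cardinality, so has_dim Y holds of at most one n; the default value 0 is     *)
(* only taken when Y is infinite-dimensional, which the uses below exclude.     *)
Definition dim (Y : set X) : nat := xget 0 [set n | has_dim Y n].

Definition locally_modular : Prop := forall A B : set X,
  cl_closed A -> cl_closed B -> finite_dim A -> finite_dim B ->
  0 < dim (A `&` B) ->
  dim (A `|` B) + dim (A `&` B) = dim A + dim B.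

End Dimension.

Definition group_automorphism (G : groupType) (f : G -> G) : Prop :=
  bijective f /\ {morph f : x y / (x * y)%g}.

Definition group_pregeometry (G : groupType) (cl : set G -> set G) : Prop :=
  pregeometry cl /\
  forall f : G -> G, group_automorphism f ->
    forall A : set G, f @` cl A = cl (f @` A).

Definition homogeneous (G : groupType) (cl : set G -> set G) : Prop :=
  ~ finite_dim cl [set: G] /\
  forall (A : set G) (b c : G), finite_set A -> ~ cl A b -> ~ cl A c ->
    exists f : G -> G,
      [/\ group_automorphism f, forall a, A a -> f a = a & f b = c].

(* Main.v *)
(** By homogeneity and infinite dimension, every element fixed by the
automorphisms fixing a finite set A lies in cl A, so closed sets are subgroups.

Let t, a, e, u be independent and v = e * u ^ a. Local modularity, applied to
cl(t,a,e) and cl(t,u,v), of dimension 3 with union of dimension 4, gives w in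
both of them and outside cl(t). Then v is in cl(t,u,w). An automorphism fixing
t, a, e, w and moving u to an independent u' puts v' = e * u' ^ a in
cl(t,u',w), and for x = u'^-1 * u the conjugate x ^ a = v'^-1 * v is in
cl(t,w,u,u'), which does not contain a; by exchange x ^ a is in cl(x).

By homogeneity x ^ a is in cl(x) for all independent a, x, hence the commutator
of x and a is in cl(x) and cl(a), so in cl(set0). It is therefore the same for
all x outside cl(a), which forces it to be 1. Since the elements outside
cl(set0) generate G, the group is commutative. *)
Require Import Defs.
From HB Require Import structures.
From mathcomp Require Import all_boot.
From mathcomp Require Import mathcomp_extra boolp classical_sets functions.
From mathcomp Require Import cardinality.

Set Implicit Arguments.
Unset Strict Implicit.
Unset Printing Implicit Defensive.

Local Open Scope classical_set_scope.
Local Open Scope card_scope.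

(** * Finite sets as duplicate-free lists *)

Lemma card_eq_uniq (T : eqType) (s : seq T) : uniq s -> [set` s] #= `I_(size s).
Proof.
elim: s => [|x s IH] /=.
  by move=> _; rewrite II0 card_eq0 set_nil.
move=> /andP[xs us]; apply/eq_cardSP; exists x; first by rewrite /= inE eqxx.
suff -> : [set` x :: s] `\ x = [set` s] by exact: IH.
apply/seteqP; split=> y /=; rewrite inE.
  by case=> /predU1P[].
by move=> ys; split; [rewrite ys orbT|move=> yx; rewrite -yx ys in xs].
Qed.

Lemma card_eq_seqP (T : eqType) (A : set T) (n : nat) :
  A #= `I_n -> exists s, [/\ uniq s, size s = n & A = [set` s]].
Proof.
move=> An; have /finite_seqP[s As] : finite_set A by apply/finite_setP; exists n.
have AU : A = [set` undup s].
  by rewrite As; apply/seteqP; split=> x /=; rewrite mem_undup.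
exists (undup s); split; rewrite ?undup_uniq//.
apply/card_eq_II; rewrite -(card_eqr An) AU card_eq_sym.
exact/card_eq_uniq/undup_uniq.
Qed.

(** * Closure and exchange in a pregeometry *)

Section Pregeometry.
Variables (X : eqType) (cl : set X -> set X).
Hypothesis pcl : pregeometry cl.

Lemma cl_sub (A B : set X) : A `<=` cl B -> cl A `<=` cl B.
Proof.
have mono (C D : set X) : C `<=` D -> cl C `<=` cl D.
  move=> CD x /(pregeometry_finitary pcl)[F [finF FC Fx]].
  by apply/(pregeometry_finitary pcl); exists F; split=> //; exact: subset_trans CD.
by move=> /mono; rewrite (pregeometry_idem pcl).
Qed.

Lemma cl_mono (A B : set X) : A `<=` B -> cl A `<=` cl B.
Proof. by move=> AB; apply: cl_sub => x /AB; exact: pregeometry_ext. Qed.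

Lemma cl_seq_sub (s s' : seq X) x :
  (forall y, y \in s -> cl [set` s'] y) -> cl [set` s] x -> cl [set` s'] x.
Proof. by move=> ss'; exact: cl_sub. Qed.

Lemma cl_seq_mono (s s' : seq X) x :
  {subset s <= s'} -> cl [set` s] x -> cl [set` s'] x.
Proof. by move=> ss'; exact: cl_mono. Qed.

Lemma mem_cl (s : seq X) x : x \in s -> cl [set` s] x.
Proof. by move=> xs; exact: pregeometry_ext. Qed.

Lemma cl_exchange (s : seq X) a b :
  ~ cl [set` s] a -> cl [set` b :: s] a -> cl [set` a :: s] b.
Proof.
have consE c : [set` c :: s] = [set` s] `|` [set c].
  apply/seteqP; split=> y /=; rewrite inE.
    by case/predU1P=> [->|]; [right|left].
  by case=> [->|->]; rewrite ?orbT ?eqxx.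
by rewrite !consE => ? ?; apply: (pregeometry_exchange pcl).
Qed.

Lemma cl_cut (s s' : seq X) x y :
  cl [set` s'] y -> {subset s <= s'} -> cl [set` y :: s] x -> cl [set` s'] x.
Proof.
move=> ys' ss'; apply: cl_seq_sub => z; rewrite inE => /predU1P[->//|/ss'].
exact: mem_cl.
Qed.

(** If some [b] in [s] came to depend on [x] and the rest of [s], exchange would put [x] in the
    closure of [s]. *)
Lemma independent_cons (s : seq X) x :
  independent cl [set` s] -> ~ cl [set` s] x -> independent cl [set` x :: s].
Proof.
move=> ind nx b /=; rewrite inE => /predU1P[->|bs].
  move=> xcl; apply: nx; apply: cl_mono xcl => y [/=].
  by rewrite inE => /predU1P[].
move=> bcl.
pose s' := filter (predC1 b) s.
have nb : ~ cl [set` s'] b.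
  move=> bs'; apply: (ind b bs); apply: cl_mono bs' => y /=.
  by rewrite mem_filter /= => /andP[/eqP].
have : cl [set` b :: s'] x.
  apply: (cl_exchange nb); apply: cl_mono bcl => y [/=].
  rewrite !inE mem_filter /= => /predU1P[->|->] yb; first by rewrite eqxx.
  by rewrite andbT; apply/orP; right; apply/eqP.
move=> xcl; apply: nx; apply: cl_seq_mono xcl => y.
by rewrite inE mem_filter => /predU1P[->|/andP[]].
Qed.

(* The Steinitz exchange argument, with the already exchanged elements in [a]. *)
Lemma independent_size (c a s : seq X) :
  uniq (a ++ c) -> independent cl [set` a ++ c] ->
  (forall x, x \in c -> cl [set` a ++ s] x) -> size c <= size s.
Proof.
elim: c a s => [//|x c IH] a s /= uac ind csub.
have nx : ~ cl [set` a] x.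
  have xac : x \in a ++ x :: c by rewrite mem_cat mem_head orbT.
  move=> xa; apply: (ind x xac); apply: cl_mono xa => y /= ya.
  split; first by rewrite mem_cat ya.
  move=> yx; move: uac; rewrite cat_uniq => /and3P[_ /hasPn/(_ x (mem_head _ _))].
  by rewrite /= -yx ya.
have xas := csub x (mem_head _ _).
(* The element [y] ends the shortest prefix of [s] that spans [x] together with [a], so [x] can
   replace it. *)
have [s1 [y [s2 [sE ycl]]]] :
    exists s1 y s2, s = s1 ++ y :: s2 /\ cl [set` x :: a ++ s1] y.
  have: forall s1 s2, s = s1 ++ s2 -> ~ cl [set` a ++ s1] x ->
    exists s1 y s2, s = s1 ++ y :: s2 /\ cl [set` x :: a ++ s1] y.
    move=> s1 s2; elim: s2 s1 => [|y s2 IHs] s1 sE ns1.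
      by rewrite cats0 in sE; rewrite -sE in ns1.
    have [xy|nxy] := pselect (cl [set` a ++ rcons s1 y] x).
      exists s1, y, s2; split => //; apply: cl_exchange => //.
      apply: cl_seq_mono xy => z.
      by rewrite !(inE, mem_cat, mem_rcons) orbCA.
    by apply: (IHs (rcons s1 y)) => //; rewrite cat_rcons.
  by move=> /(_ [::] s erefl); rewrite cats0; apply.
rewrite sE size_cat /= addnS ltnS -size_cat.
apply: (IH (rcons a x)); rewrite ?cat_rcons // => z zc.
have := csub z; rewrite inE zc orbT => /(_ isT); apply: cl_seq_sub => t.
rewrite sE !mem_cat inE => /or3P[ta|ts|/predU1P[->|ts]].
- by apply: mem_cl; rewrite mem_cat ta.
- by apply: mem_cl; rewrite !(inE, mem_cat) ts !orbT.
- apply: cl_seq_mono ycl => r; rewrite !(inE, mem_cat).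
  by case/or3P=> ->; rewrite ?orbT.
- by apply: mem_cl; rewrite !(inE, mem_cat) ts !orbT.
Qed.

(** * Bases and dimension *)

Lemma basis_max_independent (Y B : set X) :
  B `<=` Y -> Y `<=` cl B -> independent cl B -> max_independent cl Y B.
Proof.
move=> BY YB indB; split=> // C CY indC BC; apply/seteqP; split=> // c Cc.
apply: contrapT => nBc; apply: (indC c Cc); apply: cl_mono (YB _ (CY _ Cc)).
by move=> b Bb; split; [exact: BC|move=> bc; apply: nBc; rewrite -bc].
Qed.

Lemma max_independent_basis (Y : set X) (s : seq X) :
  max_independent cl Y [set` s] -> Y `<=` cl [set` s].
Proof.
move=> [sY ind max] y Yy; apply: contrapT => ny.
have ysE : [set` y :: s] = [set` s].
  apply: max; last by move=> z /= zs; rewrite inE zs orbT.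
    by move=> z /=; rewrite inE => /predU1P[->//|/sY].
  exact: independent_cons.
by apply: ny; apply: mem_cl; change ([set` s] y); rewrite -ysE /= mem_head.
Qed.

Lemma has_dim_basis (Y : set X) (s : seq X) :
  uniq s -> [set` s] `<=` Y -> Y `<=` cl [set` s] -> independent cl [set` s] ->
  has_dim cl Y (size s).
Proof.
move=> us sY Ys ind; exists [set` s]; first exact: basis_max_independent.
exact: card_eq_uniq.
Qed.

Lemma dim_basis (Y : set X) (s : seq X) :
  uniq s -> [set` s] `<=` Y -> Y `<=` cl [set` s] -> independent cl [set` s] ->
  dim cl Y = size s.
Proof.
move=> us sY Ys ind; apply: xget_unique; first exact: has_dim_basis.
move=> n [B mB /card_eq_seqP[s' [us' <- BE]]].
move: mB; rewrite BE => mB; have [s'Y ind' _] := mB.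
have Ys' := max_independent_basis mB.
(* Each of the two bases spans the other, so the exchange bound applies both ways. *)
apply/eqP; rewrite eqn_leq; apply/andP; split.
  by apply: (@independent_size s' [::]) => //= x /s'Y /Ys.
by apply: (@independent_size s [::]) => //= x /sY /Ys'.
Qed.

Lemma exists_basis (s : seq X) : exists s', [/\ uniq s', independent cl [set` s']
  & forall y, y \in s -> cl [set` s'] y].
Proof.
elim: s => [|x s [s' [us' ind ss']]]; first by exists [::]; split.
have [xs'|nxs'] := pselect (cl [set` s'] x).
  by exists s'; split=> // y; rewrite inE => /predU1P[->//|]; exact: ss'.
exists (x :: s'); split.
- by rewrite /= us' andbT; apply/negP => /mem_cl.
- exact: independent_cons.
- move=> y; rewrite inE => /predU1P[->|/ss'].
    by apply: mem_cl; exact: mem_head.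
  by apply: cl_seq_mono => z zs; rewrite inE zs orbT.
Qed.

(** Otherwise a basis extracted from [s] would be a finite basis of the whole set. *)
Lemma exists_notin_cl (s : seq X) :
  ~ finite_dim cl [set: X] -> exists x, ~ cl [set` s] x.
Proof.
move=> infd; apply: contrapT => /forallNP ns; apply: infd.
have [s' [us' ind ss']] := exists_basis s.
exists (size s'); apply: has_dim_basis => // x _.
by apply: cl_seq_sub ss' _; apply: contrapT; exact: ns.
Qed.

Lemma dim_cl_seq (s : seq X) : uniq s -> independent cl [set` s] ->
  dim cl (cl [set` s]) = size s /\ finite_dim cl (cl [set` s]).
Proof.
move=> us ind; split; first by apply: dim_basis => //; exact: mem_cl.
by exists (size s); apply: has_dim_basis => //; exact: mem_cl.
Qed.

End Pregeometry.

(** Decides inclusions between explicit lists by splitting on every equality test. *)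
Ltac subset_seq :=
  let z := fresh "z" in
  move=> z; rewrite ?inE; repeat (match goal with |- context [z == ?y] => case: (z == y) end); done.

(** * Homogeneous pregeometries on groups *)

Section HomogeneousGroup.
Variables (G : groupType) (cl : set G -> set G).
Hypotheses (gcl : group_pregeometry cl) (hcl : homogeneous cl).

Let pcl : pregeometry cl := gcl.1.

Local Open Scope group_scope.

Lemma automorphism_cl (f : G -> G) (s : seq G) x :
  group_automorphism f -> cl [set` s] x -> cl [set` map f s] (f x).
Proof.
move=> autf sx; have -> : [set` map f s] = f @` [set` s].
  apply/seteqP; split=> y /=; first by move=> /mapP[z zs ->]; exists z.
  by case=> z zs <-; apply/mapP; exists z.
by rewrite -gcl.2//; exists x.
Qed.

Lemma automorphismV (f : G -> G) x : group_automorphism f -> f x^-1 = (f x)^-1.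
Proof.
move=> [_ fM]; have f1 : f 1 = 1 by apply: (mulgI (f 1)); rewrite -fM !mulg1.
by apply: (mulgI (f x)); rewrite -fM !mulgV.
Qed.

Lemma automorphismJ (f : G -> G) x y : group_automorphism f -> f (x ^ y) = f x ^ f y.
Proof. by move=> autf; rewrite !conjgE !autf.2 automorphismV. Qed.

Lemma exists_automorphism (s : seq G) b c :
  ~ cl [set` s] b -> ~ cl [set` s] c ->
  exists f, [/\ group_automorphism f, forall a, a \in s -> f a = a & f b = c].
Proof. by move=> sb sc; apply: hcl.2 => //; exact: finite_seq. Qed.

Lemma exists_generic (s : seq G) : exists x, ~ cl [set` s] x.
Proof. exact: exists_notin_cl hcl.1. Qed.

(** If [b] were outside the closure of [s], homogeneity would move it to some [c] outside the
    closure of [b :: s], although [b] is fixed. *)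
Lemma cl_fixed (s : seq G) b :
  (forall f, group_automorphism f -> (forall a, a \in s -> f a = a) -> f b = b) ->
  cl [set` s] b.
Proof.
move=> fixb; apply: contrapT => nb; have [c nc] := exists_generic (b :: s).
have ncs : ~ cl [set` s] c.
  by move=> sc; apply: nc; apply: cl_seq_mono sc => // z zs; rewrite inE zs orbT.
have [f [autf fs fb]] := exists_automorphism nb ncs.
by apply: nc; rewrite -fb (fixb f)//; apply: mem_cl => //; exact: mem_head.
Qed.

Lemma clM (s : seq G) x y : cl [set` s] x -> cl [set` s] y -> cl [set` s] (x * y).
Proof.
move=> sx sy; apply: (@cl_seq_sub _ _ pcl [:: x; y]).
  by move=> z; rewrite !inE => /orP[]/eqP->.
by apply: cl_fixed => f [_ fM] fs; rewrite fM !fs// !inE eqxx ?orbT.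
Qed.

Lemma clV (s : seq G) x : cl [set` s] x -> cl [set` s] x^-1.
Proof.
move=> sx; apply: (@cl_seq_sub _ _ pcl [:: x]).
  by move=> z; rewrite !inE => /eqP->.
by apply: cl_fixed => f autf fs; rewrite automorphismV// fs// inE.
Qed.

Lemma clJ (s : seq G) x y : cl [set` s] x -> cl [set` s] y -> cl [set` s] (x ^ y).
Proof. by move=> sx sy; rewrite conjgE; do ?apply: clM => //; exact: clV. Qed.

(** * Consequences of local modularity *)

Section LocallyModular.
Hypothesis lm : locally_modular cl.

(** Without such a [w], the closures of [e, a, t] and of [v, u, t] meet in the closure of [t]. This
    has dimension 1, hence positive, and the modular law would read 4 + 1 = 3 + 3. *)
Lemma locally_modular_meet (t a e u v : G) :
  ~ cl [set` [::]] t -> ~ cl [set` [:: t]] a -> ~ cl [set` [:: a; t]] e ->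
  ~ cl [set` [:: e; a; t]] u -> ~ cl [set` [:: u; t]] v ->
  cl [set` [:: u; e; a; t]] v ->
  exists w, [/\ ~ cl [set` [:: t]] w, cl [set` [:: e; a; t]] w
    & cl [set` [:: v; u; t]] w].
Proof.
move=> nt na ne nu nv vcl; apply: contrapT => /forallNP noW.
have notin (s : seq G) x : ~ cl [set` s] x -> x \notin s.
  by move=> nx; apply/negP => xs; apply: nx; exact: mem_cl.
have nut : ~ cl [set` [:: t]] u.
  by move=> ut; apply: nu; apply: cl_seq_mono ut => //; subset_seq.
have ind0 : independent cl [set` [::]] by [].
have indt := independent_cons pcl ind0 nt.
have inda := independent_cons pcl indt na.
have inde := independent_cons pcl inda ne.
have indu := independent_cons pcl inde nu.
have indut := independent_cons pcl indt nut.
have indv := independent_cons pcl indut nv.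
have ueat : uniq [:: u; e; a; t].
  by rewrite 4!cons_uniq !notin.
have uvut : uniq [:: v; u; t] by rewrite 3!cons_uniq !notin.
have eat : uniq [:: e; a; t] by case/andP: ueat.
have ut : uniq [:: t] by [].
set A := cl [set` [:: e; a; t]]; set B := cl [set` [:: v; u; t]].
have [dA fA] := dim_cl_seq pcl eat inde.
have [dB fB] := dim_cl_seq pcl uvut indv.
have At : A t by apply: mem_cl => //; rewrite !inE eqxx !orbT.
have Bt : B t by apply: mem_cl => //; rewrite !inE eqxx !orbT.
have dI : dim cl (A `&` B) = 1%N.
  apply: (@dim_basis _ _ pcl _ [:: t]) => //.
    by move=> x /=; rewrite inE => /eqP->.
  by move=> x [Ax Bx]; apply: contrapT => nx; apply: (noW x).
have dU : dim cl (A `|` B) = 4%N.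
  apply: (@dim_basis _ _ pcl _ [:: u; e; a; t]) => //.
    move=> x /=; rewrite inE => /predU1P[->|xs].
      by right; apply: mem_cl => //; rewrite !inE eqxx !orbT.
    by left; exact: mem_cl.
  move=> x [Ax|Bx]; first by apply: cl_seq_mono Ax => //; subset_seq.
  by apply: (cl_cut pcl vcl _ Bx); subset_seq.
have := lm (pregeometry_idem pcl _) (pregeometry_idem pcl _) fA fB.
by rewrite -/A -/B dI dU dA dB => /(_ isT).
Qed.

Lemma exists_conjg_cl : exists a x,
  [/\ ~ cl [set` [::]] a, ~ cl [set` [:: a]] x & cl [set` [:: x]] (x ^ a)].
Proof.
have [t nt] := exists_generic [::].
have [a na] := exists_generic [:: t].
have [e ne] := exists_generic [:: a; t].
have [u nu] := exists_generic [:: e; a; t].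
have [u1 nu1] := exists_generic [:: u; e; a; t].
(* The factor [e] keeps [v] independent of [u, a, t], and it cancels later in the quotient of [v]
   and its image. *)
pose v := e * u ^ a.
have neu : ~ cl [set` [:: u; a; t]] e.
  move=> /(cl_exchange pcl ne) ue; apply: nu; apply: cl_seq_mono ue => //.
have mem (s : seq G) x : x \in s -> cl [set` s] x by exact: mem_cl.
have nv : ~ cl [set` [:: u; a; t]] v.
  move=> vcl; apply: neu; rewrite -(mulgK (u ^ a) e); apply: clM => //.
  by apply: clV; apply: clJ; apply: mem; rewrite !inE eqxx ?orbT.
have vcl : cl [set` [:: u; e; a; t]] v.
  by apply: clM; last apply: clJ; apply: mem; rewrite !inE eqxx ?orbT.
have nvut : ~ cl [set` [:: u; t]] v.
  by move=> vut; apply: nv; apply: cl_seq_mono vut => //; subset_seq.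
have [w [nw Aw Bw]] := locally_modular_meet nt na ne nu nvut vcl.
have nwut : ~ cl [set` [:: u; t]] w.
  move=> /(cl_exchange pcl nw) uw; apply: nu; apply: (cl_cut pcl Aw _ uw).
  by subset_seq.
have vw : cl [set` [:: w; u; t]] v := cl_exchange pcl nwut Bw.
(* Otherwise exchange puts [w] in the closure of [a, t], and then [v] depends on [u, a, t]. *)
have nawt : ~ cl [set` [:: w; t]] a.
  move=> /(cl_exchange pcl na) wat; apply: nv; apply: (cl_cut pcl _ _ vw).
    by apply: cl_seq_mono wat => //; subset_seq.
  by subset_seq.
(* Since [w] depends on [e, a, t], adding it to the fixed list leaves [u] and [u1] generic. *)
have [f [autf ff fu]] : exists f, [/\ group_automorphism f,
    forall b, b \in [:: w; e; a; t] -> f b = b & f u = u1].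
  apply: exists_automorphism => ucl.
    by apply: nu; apply: (cl_cut pcl Aw _ ucl); subset_seq.
  apply: nu1; apply: (cl_cut pcl _ _ ucl); last by subset_seq.
  by apply: cl_seq_mono Aw => //; subset_seq.
have v1w : cl [set` [:: w; u1; t]] (e * u1 ^ a).
  have := automorphism_cl autf vw.
  by rewrite /= /v autf.2 automorphismJ// fu !ff// !inE eqxx ?orbT.
(* Adding [u], then [u1], to [w, t] does not capture [a]: by exchange [u] would depend on [e, a, t],
   or [u1] on [u, e, a, t]. *)
have nauwt : ~ cl [set` [:: u; w; t]] a.
  move=> /(cl_exchange pcl nawt) ua; apply: nu.
  apply: (@cl_seq_sub _ _ pcl _ _ _ _ ua) => z; rewrite !inE.
  by case/or3P => /eqP-> //; apply: mem; rewrite !inE eqxx ?orbT.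
have nall : ~ cl [set` [:: u1; u; w; t]] a.
  move=> /(cl_exchange pcl nauwt) ua; apply: nu1.
  apply: (@cl_seq_sub _ _ pcl _ _ _ _ ua) => z; rewrite !inE.
  case/or4P => /eqP->; try by apply: mem; rewrite !inE eqxx ?orbT.
  by apply: cl_seq_mono Aw => //; subset_seq.
pose x := u1^-1 * u.
have xcl : cl [set` [:: u1; u; w; t]] x.
  by apply: clM; first apply: clV; apply: mem; rewrite !inE eqxx ?orbT.
have xacl : cl [set` [:: u1; u; w; t]] (x ^ a).
  have -> : x ^ a = (e * u1 ^ a)^-1 * v.
    by rewrite /v invgM -mulgA mulKg -conjVg -conjMg.
  apply: clM; first apply: clV.
    by apply: cl_seq_mono v1w => //; subset_seq.
  by apply: cl_seq_mono vw => //; subset_seq.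
exists a, x; split.
- by move=> a0; apply: na; apply: cl_seq_mono a0.
- move=> xa; apply: nu1; have -> : u1 = u * x^-1 by rewrite invgM invgK mulVKg.
  apply: clM; first by apply: mem; rewrite mem_head.
  by apply: clV; apply: cl_seq_mono xa => //; subset_seq.
(* As [x ^ a] depends on [a, x], exchange would make [a] depend on [x ^ a, x], both in the closure
   of [u1, u, w, t]. *)
- apply: contrapT => nxa; apply: nall.
  have : cl [set` [:: x ^ a; x]] a.
    by apply: cl_exchange => //; apply: clJ; apply: mem; rewrite !inE eqxx ?orbT.
  by apply: cl_seq_sub => // z; rewrite !inE => /orP[]/eqP->.
Qed.

(** Homogeneity carries the one known pair to [a, x] in two moves: first [b] to [a], then, fixing
    [a], the image of [y] to [x]. *)
Lemma conjg_cl (a x : G) : ~ cl [set` [::]] a -> ~ cl [set` [:: a]] x ->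
  cl [set` [:: x]] (x ^ a).
Proof.
move=> na nx; have [b [y [nb ny ycl]]] := exists_conjg_cl.
have [f [autf _ fb]] := exists_automorphism nb na.
have nfy : ~ cl [set` [:: a]] (f y).
  have [g fK gK] := autf.1.
  have autg : group_automorphism g.
    split; first by exists f.
    by move=> p q; apply: (can_inj fK); rewrite autf.2 !gK.
  move=> /(automorphism_cl autg) /=; rewrite fK -fb fK; exact: ny.
have [h [auth ha hy]] := exists_automorphism nfy nx.
have := automorphism_cl auth (automorphism_cl autf ycl).
by rewrite /= !automorphismJ// fb hy ha// inE.
Qed.

(** The commutator is [x^-1 * x ^ a] and also [a^-1 ^ x * a], so it depends on [x] alone and on [a]
    alone. Outside the closure of the empty set it would, by exchange, make [x] depend on [a]. *)
Lemma commg_cl0 (a x : G) : ~ cl [set` [::]] a -> ~ cl [set` [:: a]] x ->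
  cl [set` [::]] [~ x, a].
Proof.
move=> na nx.
have nx0 : ~ cl [set` [::]] x by move=> x0; apply: nx; apply: cl_seq_mono x0.
have nax : ~ cl [set` [:: x]] a by move=> /(cl_exchange pcl na).
have clx : cl [set` [:: x]] [~ x, a].
  rewrite commgEl; apply: clM; last exact: conjg_cl.
  by apply: clV; apply: mem_cl => //; exact: mem_head.
have cla : cl [set` [:: a]] [~ x, a].
  rewrite commgEr conjVg; apply: clM; last by apply: mem_cl => //; exact: mem_head.
  by apply: clV; exact: conjg_cl.
apply: contrapT => nc; apply: nx; exact: (cl_cut pcl cla _ (cl_exchange pcl nc clx)).
Qed.

(* By homogeneity over [:: c; a] the commutator c = [~ x, a] does not depend on
   x; comparing x, b and x * b gives c = c ^ b * c. *)
Lemma commg_generic (a x : G) : ~ cl [set` [::]] a -> ~ cl [set` [:: a]] x ->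
  [~ x, a] = 1.
Proof.
move=> na nx; set c := [~ x, a].
have c0 : cl [set` [::]] c by exact: commg_cl0.
have const y : ~ cl [set` [:: a]] y -> [~ y, a] = c.
  (* The automorphism may fix [c] too, because [c] adds nothing to the closure of [a]. *)
  have nca z : ~ cl [set` [:: a]] z -> ~ cl [set` [:: c; a]] z.
    move=> nz; apply: contra_not nz; apply: cl_cut => //.
    by apply: cl_seq_mono c0.
  move=> ny; have [f [autf ff fx]] := exists_automorphism (nca _ nx) (nca _ ny).
  have <- : f c = c by apply: ff; exact: mem_head.
  rewrite /c !commgEl autf.2 (automorphismV _ autf) (automorphismJ _ _ autf) fx.
  by rewrite ff// !inE eqxx orbT.
have [b nb] := exists_generic [:: x; a].
have nba : ~ cl [set` [:: a]] b.
  by move=> ba; apply: nb; apply: cl_seq_mono ba => //; subset_seq.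
have nxb : ~ cl [set` [:: a]] (x * b).
  move=> xb; apply: nb; rewrite -(mulKg x b); apply: clM.
    by apply: clV; apply: mem_cl => //; exact: mem_head.
  by apply: cl_seq_mono xb => //; subset_seq.
(* This is [[~ x * b, a] = [~ x, a] ^ b * [~ b, a]], where all three commutators equal [c]. *)
have cb : c ^ b * c = c.
  rewrite -{3}(const _ nxb) -{2}(const _ nba) /c.
  by rewrite !commgEl !conjgE !invgM !mulgA !(mulgK, mulgVK).
have : c ^ b = 1 by apply: (mulIg c); rewrite cb mul1g.
by move=> /eqP; rewrite conjg_eq1 => /eqP.
Qed.

Lemma generic_commute (a x : G) : ~ cl [set` [::]] a -> ~ cl [set` [:: a]] x ->
  commute x a.
Proof. by move=> na nx; apply/commgP/eqP; exact: commg_generic. Qed.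

(** For generic [b], both [y * b] and [b] lie outside the closure of [x], hence commute with [x]; so
    does their quotient [y]. *)
Lemma commute_notin_cl0 (x y : G) : ~ cl [set` [::]] x -> commute x y.
Proof.
move=> nx; have [b nb] := exists_generic [:: y; x].
have cxb : commute x b.
  apply: commute_sym; apply: generic_commute => // bx; apply: nb.
  by apply: cl_seq_mono bx => //; subset_seq.
have nyb : ~ cl [set` [:: x]] (y * b).
  move=> ybx; apply: nb; rewrite -(mulKg y b); apply: clM.
    by apply: clV; apply: mem_cl => //; exact: mem_head.
  by apply: cl_seq_mono ybx => //; subset_seq.
have cxyb : commute x (y * b) by apply: commute_sym; exact: generic_commute.
by rewrite -(mulgK b y); apply: commuteM => //; exact: commuteV.
Qed.

End LocallyModular.
End HomogeneousGroup.

Theorem theorem1 (G : groupType) (cl : set G -> set G)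
  (cl_pregeometry : group_pregeometry cl)
  (cl_homogeneous : homogeneous cl)
  (cl_locally_modular : locally_modular cl) :
  forall x y : G, (x * y)%g = (y * x)%g.
Proof.
move=> x y; have central := commute_notin_cl0 cl_pregeometry cl_homogeneous
  cl_locally_modular.
have [x0|] := pselect (cl [set` [::]] x); last by move=> /(central x y).
(* An [x] in the closure of the empty set is the quotient of [x * b] and [b], both outside it and
   therefore central. *)
have [b nb] := exists_generic cl_pregeometry cl_homogeneous [::].
have nxb : ~ cl [set` [::]] (x * b)%g.
  move=> xb; apply: nb; rewrite -(mulKg x b).
  by apply: clM => //; exact: clV.
apply: commute_sym; rewrite -(mulgK b x).
by apply: commuteM; last apply: commuteV; apply/commute_sym/central.
Qed.
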